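(* Let $n\ge 3$, $A\in\mathbb{R}^{n\times n}$, $B_1,B_2\in\mathbb{R}^{n\times 1}$, $C_1\in\mathbb{R}^{1\times n}$, and consider the system $\dot x=Ax+B_1w+B_2u$, $z=C_1x$, with $C_1B_2\neq 0$ and $R:=C_1B_1+B_1^TC_1^T>0$. Let $Q=I-B_2(C_1B_2)^{-1}C_1$ and $A_q=QA$. Suppose that: (a) the pair $(A,B_2)$ is controllable; (b) $A_q$ has $n$ distinct eigenvalues $\lambda_1,\dots,\lambda_n$, ordered so that $\operatorname{Re}\lambda_1\le\cdots\le\operatorname{Re}\lambda_{n-2}<0$, $\lambda_{n-1}=0$, and $\lambda_n>0$ (so $A_q$ has exactly one unstable eigenvalue); (c) the Lyapunov conditions at level $\epsilon$ (defined in the context) are satisfied for $\epsilon=0$. Let $\gamma=-\operatorname{Re}\lambda_{n-2}$. Then for every $\epsilon$ with $0<\epsilon<\gamma$ the Lyapunov conditions at level $\epsilon$ are satisfied, and the closed-loop system $\dot x=(A+B_2K)x+B_1w$, $z=C_1x$ formed with the associated feedback matrix $K$ at level $\epsilon$ (defined in the context) is SNI with degree of stability $\epsilon$.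
   Context: SNI: a square real-rational transfer function matrix $G(s)$ is strictly negative imaginary (SNI) if (i) $G(s)$ has no poles in $\operatorname{Re}[s]\ge 0$, and (ii) $j(G(j\omega)-G(j\omega)^* )>0$ for all $\omega>0$ such that $j\omega$ is not a pole of $G$. A state space system is SNI if its transfer function is; for the closed-loop system this is $G_{cl}(s)=C_1(sI-A-B_2K)^{-1}B_1$. Degree of stability: the closed-loop system has degree of stability $\epsilon$ if all eigenvalues of $A+B_2K$ have real part at most $-\epsilon$. Schur decomposition at level $\epsilon\ge 0$: put $A_r=Q(A+\epsilon I)=A_q+\epsilon Q$. Let $U$ be a real orthogonal matrix (depending on $\epsilon$) from an ordered real Schur decomposition of $A_r$, such that $$U^TA_rU=\begin{bmatrix}\tilde A_{11}&\tilde A_{12}\\0&\tilde A_{22}\end{bmatrix},$$ where $\tilde A_{11}$ has all its eigenvalues in the closed left half plane and all eigenvalues of $\tilde A_{22}$ have strictly positive real part. Partition conformably $$U^TB_1=\begin{bmatrix}\tilde B_{11}\\\tilde B_{22}\end{bmatrix},\qquad U^T\big(B_2(C_1B_2)^{-1}-B_1R^{-1}\big)=\begin{bmatrix}\tilde C_{11}\\\tilde C_{22}\end{bmatrix}.$$ Lyapunov conditions at level $\epsilon$: there exist real symmetric $T\ge 0$ and $S\ge 0$ such that $$-\tilde A_{22}T-T\tilde A_{22}^T+\tilde C_{22}R\tilde C_{22}^T=0,\qquad -\tilde A_{22}S-S\tilde A_{22}^T+\tilde B_{22}R^{-1}\tilde B_{22}^T=0,\qquad T-S>0 .$$ Associated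 feedback matrix at level $\epsilon$: given such $T,S$, $$K=(C_1B_2)^{-1}\big(B_1^TP-C_1A-\epsilon C_1-R(B_2^TC_1^T)^{-1}B_2^TP\big),\qquad P=U\begin{bmatrix}0&0\\0&(T-S)^{-1}\end{bmatrix}U^T .$$ *)

(* Defs.v *)
From HB Require Import structures.
From mathcomp Require Import all_boot all_order all_algebra.
From mathcomp Require Import reals.
From mathcomp Require Import complex.

Set Implicit Arguments.
Unset Strict Implicit.
Unset Printing Implicit Defensive.
Import Order.TTheory GRing.Theory Num.Theory.

Local Open Scope ring_scope.
Local Open Scope complex_scope.

Section MatrixNotions.
Variable F : realType.

Definition complex_mx m n (M : 'M[F]_(m, n)) : 'M[F[i]]_(m, n) :=
  map_mx (fun x : F => x%:C) M.

(* Eigenvalues of a real matrix are always taken in the complex field F[i]. *)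
Definition is_eigenvalue n (M : 'M[F]_n) (z : F[i]) : Prop :=
  eigenvalue (complex_mx M) z.

Definition sym_psd n (M : 'M[F]_n) : Prop :=
  M^T = M /\ forall x : 'cV[F]_n, 0 <= (x^T *m M *m x) 0 0.

Definition sym_pd n (M : 'M[F]_n) : Prop :=
  M^T = M /\ forall x : 'cV[F]_n, x != 0 -> 0 < (x^T *m M *m x) 0 0.

Definition adjmx m n (M : 'M[F[i]]_(m, n)) : 'M[F[i]]_(n, m) :=
  map_mx Num.conj M^T.

(* In F[i], 0 < z means that z is real and positive. *)
Definition herm_pd n (M : 'M[F[i]]_n) : Prop :=
  adjmx M = M /\
  forall x : 'cV[F[i]]_n, x != 0 -> 0 < (adjmx x *m M *m x) 0 0.

(* Kalman rank condition: [B, AB, ..., A^(n-1) B] has rank n. *)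
Definition controllable n m (A : 'M[F]_n) (B : 'M[F]_(n, m)) : Prop :=
  \rank (\mxrow_(k < n) (A ^+ k *m B)) = n.

End MatrixNotions.

Section TransferFunctions.
Variable F : realType.

(* Numerator and denominator in lowest terms. *)
Definition rat_num (f : {fraction {poly F}}) : {poly F} :=
  let num := (frac (repr f)).1 in let den := (frac (repr f)).2 in
  num %/ gcdp num den.

Definition rat_den (f : {fraction {poly F}}) : {poly F} :=
  let num := (frac (repr f)).1 in let den := (frac (repr f)).2 in
  den %/ gcdp num den.

Definition ceval (p : {poly F}) (s : F[i]) : F[i] :=
  (map_poly (fun x : F => x%:C) p).[s].

Definition tf_pole m n (G : 'M[{fraction {poly F}}]_(m, n)) (s : F[i]) : Prop :=
  exists i j, ceval (rat_den (G i j)) s = 0.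

(* Meaningful only when s is not a pole of G. *)
Definition tf_eval m n (G : 'M[{fraction {poly F}}]_(m, n)) (s : F[i]) :
  'M[F[i]]_(m, n) :=
  \matrix_(i, j) (ceval (rat_num (G i j)) s / ceval (rat_den (G i j)) s).

(* C (s I - A)^-1 B as a matrix of rational functions of s. *)
Definition tf_of_ss n m l (A : 'M[F]_n) (B : 'M[F]_(n, m)) (C : 'M[F]_(l, n)) :
  'M[{fraction {poly F}}]_(l, m) :=
  map_mx (fun x : F => tofrac x%:P) C
  *m invmx (map_mx (@tofrac _) (char_poly_mx A))
  *m map_mx (fun x : F => tofrac x%:P) B.

Definition SNI m (G : 'M[{fraction {poly F}}]_m) : Prop :=
  (forall s : F[i], 0 <= complex.Re s -> ~ tf_pole G s) /\
  (forall w : F, 0 < w -> ~ tf_pole G (0 +i* w) ->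
     herm_pd ('i *: (tf_eval G (0 +i* w) - adjmx (tf_eval G (0 +i* w))))).

Definition degree_of_stability n (M : 'M[F]_n) (eps : F) : Prop :=
  forall z : F[i], is_eigenvalue M z -> complex.Re z <= - eps.

End TransferFunctions.

Section FeedbackDesign.
Variable F : realType.

Definition Rmx n (B1 : 'cV[F]_n) (C1 : 'rV[F]_n) : 'M[F]_1 :=
  C1 *m B1 + B1^T *m C1^T.

Definition Qmx n (B2 : 'cV[F]_n) (C1 : 'rV[F]_n) : 'M[F]_n :=
  1%:M - B2 *m invmx (C1 *m B2) *m C1.

Definition Aqmx n (A : 'M[F]_n) (B2 : 'cV[F]_n) (C1 : 'rV[F]_n) : 'M[F]_n :=
  Qmx B2 C1 *m A.

Definition Armx n (A : 'M[F]_n) (B2 : 'cV[F]_n) (C1 : 'rV[F]_n) (eps : F) :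
  'M[F]_n := Qmx B2 C1 *m (A + eps%:M).

(* Upper quasi-triangular, with diagonal blocks that are either 1 x 1 or 2 x 2
   without real eigenvalues. *)
Definition real_schur_form n (M : 'M[F]_n) : Prop :=
  [/\ forall i j : 'I_n, (j.+1 < i)%N -> M i j = 0,
      forall i j k : 'I_n, j = i.+1 :> nat -> k = j.+1 :> nat ->
        M j i = 0 \/ M k j = 0
    & forall i j : 'I_n, j = i.+1 :> nat -> M j i != 0 ->
        forall x : F,
          ~~ eigenvalue (mxsub (tnth [tuple i; j]) (tnth [tuple i; j]) M) x].

(* U is an n x (p + q) matrix rather than an n x n one so that the block
   partition needs no cast; the two orthogonality equations force p + q = n.
   The blocks have sizes p (closed left half plane) and q (open right half
   plane). *)
Definition ordered_schur n p q (A : 'M[F]_n) (B2 : 'cV[F]_n) (C1 : 'rV[F]_n)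
    (eps : F) (U : 'M[F]_(n, p + q)) : Prop :=
  let M : 'M[F]_(p + q) := U^T *m Armx A B2 C1 eps *m U in
  [/\ U^T *m U = 1%:M /\ U *m U^T = 1%:M,
      real_schur_form M,
      dlsubmx M = 0,
      forall z : F[i], is_eigenvalue (ulsubmx M) z -> complex.Re z <= 0
    & forall z : F[i], is_eigenvalue (drsubmx M) z -> 0 < complex.Re z].

Definition At22 n p q (A : 'M[F]_n) (B2 : 'cV[F]_n) (C1 : 'rV[F]_n)
    (eps : F) (U : 'M[F]_(n, p + q)) : 'M[F]_q :=
  drsubmx (U^T *m Armx A B2 C1 eps *m U).

Definition Bt22 n p q (B1 : 'cV[F]_n) (U : 'M[F]_(n, p + q)) : 'cV[F]_q :=
  dsubmx (U^T *m B1).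

Definition Ct22 n p q (B1 B2 : 'cV[F]_n) (C1 : 'rV[F]_n)
    (U : 'M[F]_(n, p + q)) : 'cV[F]_q :=
  dsubmx (U^T *m (B2 *m invmx (C1 *m B2) - B1 *m invmx (Rmx B1 C1))).

Definition lyapunov_pair n p q (A : 'M[F]_n) (B1 B2 : 'cV[F]_n)
    (C1 : 'rV[F]_n) (eps : F) (U : 'M[F]_(n, p + q)) (T S : 'M[F]_q) : Prop :=
  let A22 := At22 A B2 C1 eps U in
  let B22 := Bt22 B1 U in
  let C22 := Ct22 B1 B2 C1 U in
  let R := Rmx B1 C1 in
  [/\ sym_psd T,
      sym_psd S,
      - A22 *m T - T *m A22^T + C22 *m R *m C22^T = 0,
      - A22 *m S - S *m A22^T + B22 *m invmx R *m B22^T = 0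
    & sym_pd (T - S)].

Definition lyapunov_conditions n p q (A : 'M[F]_n) (B1 B2 : 'cV[F]_n)
    (C1 : 'rV[F]_n) (eps : F) (U : 'M[F]_(n, p + q)) : Prop :=
  exists T S : 'M[F]_q, lyapunov_pair A B1 B2 C1 eps U T S.

Definition Pmx n p q (U : 'M[F]_(n, p + q)) (T S : 'M[F]_q) : 'M[F]_n :=
  U *m block_mx (0 : 'M[F]_p) 0 0 (invmx (T - S)) *m U^T.

Definition feedback n p q (A : 'M[F]_n) (B1 B2 : 'cV[F]_n) (C1 : 'rV[F]_n)
    (eps : F) (U : 'M[F]_(n, p + q)) (T S : 'M[F]_q) : 'rV[F]_n :=
  let P := Pmx U T S in
  invmx (C1 *m B2) *m
    (B1^T *m P - C1 *m A - eps *: C1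
     - Rmx B1 C1 *m invmx (B2^T *m C1^T) *m B2^T *m P).

End FeedbackDesign.

(* Main.v *)
(** The block A~22 is 1 x 1, because A_r has the eigenvalue 0 (left eigenvector
    C1) and the eigenvalues lam_i + eps for i <> n - 1.  Let u be the last
    column of U, a left eigenvector of A_r for its only unstable eigenvalue
    mu, and put D = B2 (C1 B2)^-1, b = u^T D, w = u^T B1.  Subtracting the two
    scalar Lyapunov equations gives 2 mu (T - S) = b (R b - 2 w).  Replacing
    level 0 by level eps replaces u by a multiple of u - (eps / mu) b C1^T,
    which multiplies b (R b - 2 w) by a positive number, so T - S > 0 is
    inherited.

    The feedback only adds a rank one term,
    A + B2 K + eps I = A_r + kappa D u^T with kappa = (w - R b) / (T - S), and
    moves mu to nu = mu + kappa b = - R b^2 / (2 (T - S)) < 0.  The span of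
    C1 and u^T is left invariant, whence
    G_cl(s) = (R/2) (s + eps + c) / ((s + eps) (s + eps - nu)) with
    c = 2 kappa w / R - nu >= 0, whose imaginary part is negative at every
    s = j omega with omega > 0. *)

Require Import Defs.
From HB Require Import structures.
From mathcomp Require Import all_boot all_order all_algebra separable.
From mathcomp Require Import reals.
From mathcomp Require Import complex.
From mathcomp Require Import ring lra zify.
Import Order.TTheory GRing.Theory Num.Theory.
Local Open Scope ring_scope.
Local Open Scope complex_scope.

Set Implicit Arguments.
Unset Strict Implicit.
Unset Printing Implicit Defensive.

(** * Evaluation of rational functions and an SNI criterion of second order *)

Lemma cevalM (F : realType) (p q : {poly F}) (s : F[i]) :
  ceval (p * q) s = ceval p s * ceval q s.
Proof. by rewrite /ceval rmorphM hornerM. Qed.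

Lemma cevalXDC (F : realType) (a : F) (s : F[i]) :
  ceval ('X + a%:P) s = s + a%:C.
Proof. by rewrite /ceval rmorphD /= map_polyX map_polyC !hornerE. Qed.

Lemma cevalZ (F : realType) (a : F) (p : {poly F}) (s : F[i]) :
  ceval (a *: p) s = a%:C * ceval p s.
Proof. by rewrite /ceval linearZ /= hornerZ. Qed.

Lemma repr_fraction (K : fieldType) (f : {fraction {poly K}}) :
  tofrac (frac (repr f)).1 = f * tofrac (frac (repr f)).2.
Proof.
rewrite -{2}[f]reprK; move: (repr f) => x; unlock tofrac.
rewrite -[RHS]FracField.pi_mul; apply/eqP; rewrite eqmodE /= FracField.equivfE.
by rewrite /FracField.mulf !numden_Ratio ?mulr1 ?mul1r ?oner_neq0 ?denom_ratioP.
Qed.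

Lemma rat_num_den_coprime (F : realType) (f : {fraction {poly F}}) :
  coprimep (rat_num f) (rat_den f).
Proof. by apply: coprimep_div_gcd; rewrite denom_ratioP orbT. Qed.

(** The identity holds for the chosen representative by cross multiplication; the common gcd,
    nonzero because the denominator is, then cancels. *)
Lemma rat_num_den_cross (F : realType) (f : {fraction {poly F}}) (p q : {poly F}) :
  f * tofrac q = tofrac p -> rat_num f * q = p * rat_den f.
Proof.
set x := frac (repr f); set g := gcdp x.1 x.2 => fq.
have g0 : g != 0 by rewrite gcdp_eq0 negb_and denom_ratioP orbT.
have h : x.1 * q = p * x.2.
  apply/eqP; rewrite -tofrac_eq !tofracM -fq repr_fraction; apply/eqP.
  by rewrite mulrAC.
apply: (mulfI g0); rewrite mulrCA !mulrA [g * _]mulrC /rat_num -/x -/g.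
rewrite divpK ?dvdp_gcdl // h /rat_den -/x -/g -!mulrA; congr (_ * _).
by rewrite [RHS]mulrC divpK ?dvdp_gcdr.
Qed.

(** Coprimality with the numerator makes [rat_den f] divide [q]. Poles and values can therefore be
    read off from any representation [p / q], reduced or not, wherever [q] does not vanish. *)
Lemma tf_entry_eval (F : realType) (f : {fraction {poly F}}) (p q : {poly F})
    (s : F[i]) :
  f * tofrac q = tofrac p -> ceval q s != 0 ->
  ceval (rat_den f) s != 0 /\
  ceval (rat_num f) s / ceval (rat_den f) s = ceval p s / ceval q s.
Proof.
move=> /rat_num_den_cross fq q0.
have den0 : ceval (rat_den f) s != 0.
  have : rat_den f %| q.
    rewrite -(@Gauss_dvdpr _ _ (rat_num f)) ?fq ?dvdp_mull //.
    by rewrite coprimep_sym rat_num_den_coprime.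
  move=> /dvdpP[k qE]; apply: contra_neq q0 => d0.
  by rewrite qE cevalM d0 mulr0.
split=> //; apply/eqP; by rewrite eqr_div // -!cevalM fq.
Qed.

Lemma herm_pd1 (F : realType) (M : 'M[F[i]]_1) : 0 < M 0 0 -> herm_pd M.
Proof.
move=> M_gt0; split.
  apply/matrixP=> i j; rewrite !ord1 !mxE.
  by apply/CrealP; rewrite realE ltW.
move=> x x0; rewrite !mxE big_ord1 !mxE big_ord1 !mxE.
have x00 : x 0 0 != 0.
  by apply: contra_neq x0 => x00; apply/matrixP=> i j; rewrite !ord1 mxE.
by rewrite mulrAC mulr_gt0 // mulrC -normCK exprn_gt0 // normr_gt0.
Qed.

(** Multiplying by the conjugate of the denominator shows that the imaginary part at [j w] is a
    negative multiple of [w ^+ 2 + z * (b1 + b2) - b1 * b2]. *)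
Lemma SNI_second_order (F : realType) (G : 'M[{fraction {poly F}}]_1)
    (r z b1 b2 : F) :
  0 < r -> 0 < b1 -> 0 < b2 -> b1 * b2 <= z * (b1 + b2) ->
  G 0 0 * tofrac (('X + b1%:P) * ('X + b2%:P)) = tofrac (r *: ('X + z%:P)) ->
  SNI G.
Proof.
move=> r0 b10 b20 hz GE.
have q0 s : 0 <= complex.Re s -> ceval (('X + b1%:P) * ('X + b2%:P)) s != 0.
  case: s => x y /= x0; rewrite cevalM !cevalXDC mulf_neq0 // eq_complex /=;
  by rewrite negb_and gt_eqF //; lra.
split=> [s s0 [i [j]]|w w0 _].
  by rewrite !ord1; apply/eqP; case: (tf_entry_eval GE (q0 _ s0)).
have qw := q0 (0 +i* w) (lexx (0 : F)).
have [_ gE] := tf_entry_eval GE qw.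
apply: herm_pd1; rewrite !mxE gE.
move: qw; rewrite cevalM cevalZ !cevalXDC.
set D := _ * _; set N := _%:C * _ => D0.
(* The squared modulus of the denominator [D]. *)
pose m := (b1 ^+ 2 + w ^+ 2) * (b2 ^+ 2 + w ^+ 2).
have m0 : 0 < m by rewrite mulr_gt0 // ltr_pwDl ?exprn_gt0 ?sqr_ge0.
have gm : N / D * m%:C =
    r%:C * (z +i* w) * ((b1 +i* (- w)) * (b2 +i* (- w))).
  have -> : m%:C = D * ((b1 +i* (- w)) * (b2 +i* (- w))).
    by rewrite /m /D; apply/eqP; rewrite eq_complex /=; apply/andP; split; apply/eqP; ring.
  rewrite mulrA divfK // /N; congr (_ * _ * _).
  by apply/eqP; rewrite eq_complex /= add0r addr0 !eqxx.
move: (N / D) gm => [x y] /eqP; rewrite eq_complex /= => /andP[_ /eqP hy].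
have y0 : y < 0.
  rewrite -(pmulr_llt0 _ m0).
  have -> : y * m = - (r * w * (w ^+ 2 + (z * (b1 + b2) - b1 * b2))).
    by move: hy; rewrite mulr0 add0r => ->; ring.
  rewrite oppr_lt0; apply: mulr_gt0; first exact: mulr_gt0.
  by rewrite ltr_pwDl ?exprn_gt0 ?subr_ge0.
set X := _ * _; have -> : X = (- (2 * y))%:C.
  by apply/eqP; rewrite /X eq_complex /=; apply/andP; split; apply/eqP; ring.
by rewrite ltcR oppr_gt0 pmulr_rlt0.
Qed.

(** * Left eigenvectors and block triangular matrices *)

Lemma mx1_unit (K : fieldType) (M : 'M[K]_1) : M != 0 -> M \in unitmx.
Proof.
move=> M0; rewrite unitmxE det_mx11 unitfE; apply: contra_neq M0 => M00.
by apply/matrixP=> i j; rewrite !ord1 mxE.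
Qed.

(* Here 1 - D C is the projection Q, with D = B2 (C1 B2)^-1. *)
Lemma left_eigenvector_shift (K : fieldType) n (A : 'M[K]_n) (D : 'cV[K]_n)
    (C v : 'rV[K]_n) (l e : K) :
  C *m D = 1%:M -> v *m ((1%:M - D *m C) *m A) = l *: v -> l + e != 0 ->
  let u := v - (e / (l + e)) *: (v *m D *m C) in
  u *m ((1%:M - D *m C) *m (A + e%:M)) = (l + e) *: u.
Proof.
move=> CD1 vA le0 u.
have CQ : C *m (1%:M - D *m C) = 0.
  by rewrite mulmxBr mulmx1 mulmxA CD1 mul1mx subrr.
have uQ : u *m (1%:M - D *m C) = v *m (1%:M - D *m C).
  by rewrite mulmxBl -scalemxAl -[v *m D *m C *m _]mulmxA CQ mulmx0 scaler0 subr0.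
rewrite mulmxA uQ mulmxDr mul_mx_scalar -mulmxA vA mulmxBr mulmx1 mulmxA /u.
by rewrite !scalerBr scalerA [_ * (e / _)]mulrC divfK // scalerDl addrA.
Qed.

(** Otherwise [v] would be a multiple of [C], which the projection [1 - D C] kills from the left,
    and [l *: v] would vanish. *)
Lemma left_eigenvector_shift_neq0 (K : fieldType) n (A : 'M[K]_n)
    (D : 'cV[K]_n) (C v : 'rV[K]_n) (l t : K) :
  C *m D = 1%:M -> v *m ((1%:M - D *m C) *m A) = l *: v -> l != 0 ->
  v != 0 -> v - t *: (v *m D *m C) != 0.
Proof.
move=> CD1 vA l0; apply: contra_neq => /eqP; rewrite subr_eq0 => /eqP vE.
have CQ : C *m (1%:M - D *m C) = 0.
  by rewrite mulmxBr mulmx1 mulmxA CD1 mul1mx subrr.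
have : l *: v = 0.
  rewrite -vA mulmxA vE -scalemxAl -[v *m D *m C *m _]mulmxA CQ.
  by rewrite mulmx0 scaler0 mul0mx.
by move=> /eqP; rewrite scaler_eq0 (negbTE l0) => /eqP.
Qed.

(** With a zero lower left block, the first component of a row vector is acted on by the upper left
    block alone. *)
Lemma block_trig_eigenvector (K : fieldType) p q (M : 'M[K]_(p + q))
    (y : 'rV[K]_(p + q)) (h : K) :
  dlsubmx M = 0 -> y *m M = h *: y ->
  lsubmx y *m ulsubmx M = h *: lsubmx y /\
  (lsubmx y = 0 -> rsubmx y *m drsubmx M = h *: rsubmx y).
Proof.
move=> dl0; rewrite -{1}[M]submxK dl0 -[y]hsubmxK mul_row_block scale_row_mx.
move=> /eq_row_mx[]; rewrite mulmx0 addr0 !row_mxKl !row_mxKr => h1 h2.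
by split=> // y0; rewrite -h2 y0 mul0mx add0r.
Qed.

Lemma block_trig_unstable_left (K : fieldType) p q (M : 'M[K]_(p + q))
    (y : 'rV[K]_(p + q)) (h : K) :
  dlsubmx M = 0 -> ~~ eigenvalue (ulsubmx M) h -> y *m M = h *: y ->
  lsubmx y = 0.
Proof.
move=> dl0 hM /(block_trig_eigenvector dl0)[yl _].
by apply/eqP; apply: contraNT hM => y0; apply/eigenvalueP; exists (lsubmx y).
Qed.

Lemma block_trig_eigenvalue (K : fieldType) p q (M : 'M[K]_(p + q)) (h : K) :
  dlsubmx M = 0 -> eigenvalue M h ->
  eigenvalue (ulsubmx M) h \/ eigenvalue (drsubmx M) h.
Proof.
move=> dl0 /eigenvalueP[y yM y0].
have [ly ry] := block_trig_eigenvector dl0 yM.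
have [l0|l0] := eqVneq (lsubmx y) 0; last first.
  by left; apply/eigenvalueP; exists (lsubmx y).
right; apply/eigenvalueP; exists (rsubmx y); first exact: ry.
by apply: contra_neq y0 => r0; rewrite -[y]hsubmxK l0 r0 row_mx0.
Qed.

Lemma char_poly_block_trig (K : comNzRingType) p q (M : 'M[K]_(p + q)) :
  dlsubmx M = 0 ->
  char_poly M = char_poly (ulsubmx M) * char_poly (drsubmx M).
Proof.
move=> dl0; rewrite -(det_ublock _ (- map_mx polyC (ursubmx M))); congr (\det _).
rewrite /char_poly_mx -{1}[M]submxK dl0 map_block_mx scalar_mx_block.
by rewrite opp_block_mx add_block_mx map_mx0 oppr0 addr0 add0r.
Qed.

Lemma char_poly_simple_separable (K : fieldType) n (M : 'M[K]_n) (zs : seq K) :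
  uniq zs -> size zs = n -> (forall z, z \in zs -> eigenvalue M z) ->
  char_poly M = \prod_(z <- zs) ('X - z%:P).
Proof.
move=> uz sz ez; rewrite [LHS](@all_roots_prod_XsubC _ _ zs).
- by rewrite (monicP (char_poly_monic M)) scale1r.
- by rewrite size_char_poly sz.
- by apply/allP=> z /ez; rewrite eigenvalue_root_char.
- by rewrite uniq_rootsE.
Qed.

(** The characteristic polynomial of the lower right block divides that of [M], which has simple
    roots [zs]; its own roots are thus distinct and all equal to [m], so [q <= 1]. Conversely an
    eigenvector for [m] has zero first component, so it would vanish if [q] were 0. *)
Lemma drblock_size1 (K : closedFieldType) p q (M : 'M[K]_(p + q)) (zs : seq K)
    (m : K) :
  dlsubmx M = 0 -> uniq zs -> size zs = (p + q)%N ->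
  (forall z, z \in zs -> eigenvalue M z) ->
  m \in zs -> ~~ eigenvalue (ulsubmx M) m ->
  (forall z, z \in zs -> eigenvalue (drsubmx M) z -> z = m) -> q = 1%N.
Proof.
move=> dl0 uz sz ez mz mul zm; apply/eqP; rewrite eqn_leq; apply/andP; split.
  have cM := char_poly_simple_separable uz sz ez.
  have [rs] := closed_field_poly_normal (char_poly (drsubmx M)).
  rewrite (monicP (char_poly_monic _)) scale1r => rsE.
  have drdv : char_poly (drsubmx M) %| char_poly M.
    by rewrite char_poly_block_trig // dvdp_mull.
  have urs : uniq rs.
    rewrite -separable_prod_XsubC -rsE; apply: dvdp_separable drdv _.
    by rewrite cM separable_prod_XsubC.
  have <- : size rs = q.
    by apply: succn_inj; rewrite -(size_char_poly (drsubmx M)) rsE size_prod_XsubC.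
  apply: (@uniq_leq_size _ _ [:: m]) => // z zrs.
  have rz : root (char_poly (drsubmx M)) z by rewrite rsE root_prod_XsubC.
  rewrite inE; apply/eqP/zm; last by rewrite eigenvalue_root_char.
  by rewrite -root_prod_XsubC -cM; move: rz; rewrite -!dvdp_XsubCl => /dvdp_trans; apply.
have /eigenvalueP[y yM y0] := ez m mz.
rewrite lt0n; apply: contra_neq y0 => q0.
rewrite -[y]hsubmxK (block_trig_unstable_left dl0 mul yM).
have -> : rsubmx y = 0 by apply/matrixP=> i j; have := ltn_ord j; rewrite {2}q0.
by rewrite row_mx0.
Qed.

(** * The spectrum of [Armx] and the size of its unstable block *)

Lemma mul_C1_Armx (F : realType) n (A : 'M[F]_n) (B2 : 'cV[F]_n)
    (C1 : 'rV[F]_n) (eps : F) :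
  C1 *m B2 != 0 -> C1 *m Armx A B2 C1 eps = 0.
Proof.
move=> CB; rewrite /Armx /Qmx mulmxA mulmxBr mulmx1 !mulmxA mulmxV ?mx1_unit //.
by rewrite mul1mx subrr mul0mx.
Qed.

Lemma orthogonal_conj_eigenvalue (F : realType) n m (A : 'M[F]_n)
    (U : 'M[F]_(n, m)) (z : F[i]) :
  U *m U^T = 1%:M -> is_eigenvalue A z -> is_eigenvalue (U^T *m A *m U) z.
Proof.
move=> UU /eigenvalueP[x xA x0]; apply/eigenvalueP.
have cUU : complex_mx U *m complex_mx U^T = 1%:M.
  by rewrite /complex_mx -map_mxM UU map_scalar_mx.
exists (x *m complex_mx U).
  rewrite /complex_mx !map_mxM !mulmxA -[x *m _ *m _]mulmxA.
  by rewrite -/(complex_mx _) cUU mulmx1 xA scalemxAl.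
by apply: contra_neq x0 => xU; rewrite -[x]mulmx1 -cUU mulmxA xU mul0mx.
Qed.

Lemma Aqmx_eigenvalue_shift (F : realType) n (A : 'M[F]_n) (B2 : 'cV[F]_n)
    (C1 : 'rV[F]_n) (eps : F) (z : F[i]) :
  C1 *m B2 != 0 -> is_eigenvalue (Aqmx A B2 C1) z -> z != 0 ->
  z + eps%:C != 0 -> is_eigenvalue (Armx A B2 C1 eps) (z + eps%:C).
Proof.
move=> CB /eigenvalueP[v vA v0] z0 ze0.
set D := B2 *m invmx (C1 *m B2).
have CD : complex_mx C1 *m complex_mx D = 1%:M.
  by rewrite /complex_mx -map_mxM mulmxA mulmxV ?mx1_unit // map_scalar_mx.
have QE : complex_mx (Qmx B2 C1) = 1%:M - complex_mx D *m complex_mx C1.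
  by rewrite /complex_mx map_mxB map_mxM map_scalar_mx.
have ArE : complex_mx (Armx A B2 C1 eps) =
    complex_mx (Qmx B2 C1) *m (complex_mx A + (eps%:C)%:M).
  by rewrite /Armx /complex_mx map_mxM; congr (_ *m _); rewrite map_mxD map_scalar_mx.
move: vA; rewrite /is_eigenvalue ArE /Aqmx [complex_mx (_ *m _)]map_mxM.
rewrite -!/(complex_mx _) QE => vA; apply/eigenvalueP; eexists.
  exact: left_eigenvector_shift CD vA ze0.
exact: left_eigenvector_shift_neq0 CD vA z0 v0.
Qed.

Lemma Armx_eigenvalue0 (F : realType) n (A : 'M[F]_n) (B2 : 'cV[F]_n)
    (C1 : 'rV[F]_n) (eps : F) :
  C1 *m B2 != 0 -> is_eigenvalue (Armx A B2 C1 eps) 0.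
Proof.
move=> CB; apply/eigenvalueP; exists (complex_mx C1).
  by rewrite /complex_mx -map_mxM mul_C1_Armx // map_mx0 scale0r.
rewrite map_mx_eq0; apply: contra_neq CB => ->; exact: mul0mx.
Qed.

(** Stated for [0 <= eps] so that it serves both level 0 and the target level. The bound on [eps]
    keeps the shifted stable eigenvalues in the open left half plane. *)
Lemma unstable_block_size1 (F : realType) (n : nat) (hn : (3 <= n)%N)
  (A : 'M[F]_n) (B2 : 'cV[F]_n) (C1 : 'rV[F]_n)
  (hC1B2 : C1 *m B2 != 0)
  (lam : nat -> F[i])
  (lam_eig : forall k : nat, (1 <= k <= n)%N ->
     is_eigenvalue (Aqmx A B2 C1) (lam k))
  (lam_distinct : forall k l : nat, (1 <= k <= n)%N -> (1 <= l <= n)%N ->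
     lam k = lam l -> k = l)
  (lam_ordered : forall k l : nat, (1 <= k)%N -> (k <= l)%N ->
     (l <= n - 2)%N -> complex.Re (lam k) <= complex.Re (lam l))
  (lam_stable : complex.Re (lam (n - 2)%N) < 0)
  (lam_zero : lam (n - 1)%N = 0)
  (lam_unstable : 0 < lam n) (eps : F) (p q : nat) (U : 'M[F]_(n, p + q)) :
  0 <= eps -> eps < - complex.Re (lam (n - 2)%N) ->
  ordered_schur A B2 C1 eps U -> q = 1%N.
Proof.
move=> eps0 epsg [[UtU UUt] _ dl0 ul_le0 dr_gt0].
set M := U^T *m _ *m U in dl0 ul_le0 dr_gt0.
(* The eigenvalues of [Armx]: the 0 at index [n - 1] stays in place, all others move by [eps]. *)
pose f k := if k == (n - 1)%N then 0 else lam k + eps%:C.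
have lamn : 0 < complex.Re (lam n).
  by move: lam_unstable; case: (lam n) => x y; rewrite ltcE => /andP[].
have fn : 0 < complex.Re (f n).
  rewrite /f ifN; last by apply/eqP; lia.
  by move: lamn; case: (lam n) => x y /=; lra.
have fle k : (1 <= k <= n - 2)%N -> complex.Re (f k) < 0.
  move=> /andP[k1 kn]; have := lam_ordered k _ k1 kn (leqnn _).
  rewrite /f ifN; last by apply/eqP; lia.
  by move: epsg; case: (lam k) => x y /=; lra.
have Re_f k : (1 <= k <= n)%N -> k != (n - 1)%N -> complex.Re (f k) != 0.
  move=> kn kn1; have [->|kn2] := eqVneq k n; first by rewrite gt_eqF.
  by rewrite lt_eqF // fle //; lia.
have feig k : (1 <= k <= n)%N -> is_eigenvalue (Armx A B2 C1 eps) (f k).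
  move=> kn; have := Re_f k kn; rewrite /f; case: eqVneq => [_ _|kn1 /(_ isT) h].
    exact: Armx_eigenvalue0.
  apply: Aqmx_eigenvalue_shift => //; first exact: lam_eig.
    apply: contra_neq kn1 => lk; apply: lam_distinct; [lia|lia|].
    by rewrite lk lam_zero.
  by apply: contra_neq h => ->.
(* The unshifted 0 might collide with a shifted eigenvalue; the nonzero real parts [Re_f] exclude
   this. *)
have finj k l : (1 <= k <= n)%N -> (1 <= l <= n)%N -> f k = f l -> k = l.
  move=> kn ln fkl; have := Re_f k kn; have := Re_f l ln; rewrite -fkl.
  have [->|kn1] := eqVneq k (n - 1)%N; have [ln1|ln1] := eqVneq l (n - 1)%N => //.
  - by move=> /(_ isT); rewrite /f !eqxx.
  - by move=> _ /(_ isT); rewrite fkl /f ln1 !eqxx.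
  - move=> _ _; move: fkl; rewrite /f !ifN // => /addIr; exact: lam_distinct.
have npq : (p + q)%N = n.
  by apply/eqP; rewrite eqn_leq (mulmx1_min UtU) (mulmx1_min UUt).
apply: (@drblock_size1 _ p q (complex_mx M) (map f (iota 1 n)) (f n)).
- by rewrite /complex_mx -map_dlsubmx dl0 map_mx0.
- rewrite map_inj_in_uniq ?iota_uniq // => k l; rewrite !mem_iota => hk hl.
  by apply: finj; lia.
- by rewrite size_map size_iota.
- move=> _ /mapP[k + ->]; rewrite mem_iota => hk.
  by apply: orthogonal_conj_eigenvalue UUt _; apply: feig; lia.
- by apply: map_f; rewrite mem_iota; lia.
- apply/negP; rewrite /complex_mx -map_ulsubmx => /ul_le0.
  by rewrite leNgt fn.
- move=> _ /mapP[k + ->]; rewrite mem_iota /complex_mx -map_drsubmx => hk /dr_gt0.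
  move=> fk; have [->//|kn] := eqVneq k n.
  have [kE|kn1] := eqVneq k (n - 1)%N.
    by move: fk; rewrite /f kE eqxx ltxx.
  by have := fle k; rewrite ltNge (ltW fk) => /(_ _)/negP; case; lia.
Qed.

Lemma orthogonal_block_cols (F : realType) n p q (U : 'M[F]_(n, p + q)) :
  U^T *m U = 1%:M ->
  (rsubmx U)^T *m lsubmx U = 0 /\ (rsubmx U)^T *m rsubmx U = 1%:M.
Proof.
rewrite -{1 2}[U]hsubmxK tr_row_mx mul_col_row (scalar_mx_block p q 1).
by move=> /eq_block_mx[].
Qed.

(** * The unstable left eigenvector *)

Section OrderedSchur.
Variables (F : realType) (n p : nat) (A : 'M[F]_n) (B2 : 'cV[F]_n)
  (C1 : 'rV[F]_n) (eps : F) (U : 'M[F]_(n, p + 1)).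
Hypothesis hU : ordered_schur A B2 C1 eps U.

Let u := rsubmx U.
Let m := At22 A B2 C1 eps U 0 0.

Lemma unstable_eigenvalue_gt0 : 0 < m.
Proof.
case: hU => _ _ _ _ /(_ m%:C); rewrite -/(At22 _ _ _ _ U) -ltcR ltcE /= eqxx /=.
apply; rewrite /is_eigenvalue eigenvalue_map; apply/eigenvalueP.
by exists 1%:M; rewrite ?oner_neq0 // mul1mx [LHS]mx11_scalar scalemx1.
Qed.

Lemma unstable_left_eigenvector : u^T *m Armx A B2 C1 eps = m *: u^T.
Proof.
case: hU => -[UtU UUt] _ dl0 _ _.
set M := U^T *m _ *m U in dl0.
have yM : row_mx 0 1%:M *m M = m *: row_mx 0 1%:M :> 'rV_(p + 1).
  rewrite -[M in LHS]submxK dl0 mul_row_block !mul0mx !mul1mx !add0r.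
  by rewrite scale_row_mx scaler0 scalemx1 [drsubmx M]mx11_scalar.
have yU : row_mx 0 1%:M *m U^T = u^T.
  by rewrite -[U]hsubmxK tr_row_mx mul_row_col mul0mx add0r mul1mx.
have := congr1 (mulmx^~ U^T) yM; rewrite -scalemxAl yU => <-.
by rewrite /M !mulmxA yU -!mulmxA UUt mulmx1.
Qed.

(** A positive [h] is no eigenvalue of the upper left block, so in the basis [U] only the last
    coordinate of [x] survives. *)
Lemma unstable_left_eigenvector_unique (x : 'rV[F]_n) (h : F) :
  0 < h -> x *m Armx A B2 C1 eps = h *: x -> exists c, x = c *: u^T.
Proof.
case: hU => -[UtU UUt] _ dl0 ul_le0 _ h0 xA.
set M := U^T *m _ *m U in dl0 ul_le0.
have yM : x *m U *m M = h *: (x *m U).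
  by rewrite /M 2!mulmxA -[x *m U *m _]mulmxA UUt mulmx1 xA -scalemxAl.
have ulh : ~~ eigenvalue (ulsubmx M) h.
  rewrite -(eigenvalue_map (real_complex F)); apply/negP => /ul_le0 /=.
  by rewrite leNgt h0.
have ly := block_trig_unstable_left dl0 ulh yM.
exists (rsubmx (x *m U) 0 0).
rewrite -[LHS]mulmx1 -UUt mulmxA -[x *m U]hsubmxK ly row_mxKr.
rewrite -[U in U^T]hsubmxK tr_row_mx mul_row_col mul0mx add0r.
by rewrite [rsubmx (x *m U)]mx11_scalar mul_scalar_mx !mxE.
Qed.

End OrderedSchur.

(* The quantity b (R b - 2 w) for the row vector x in place of u^T; R is scalar. *)
Definition gap (F : realType) n (B1 B2 : 'cV[F]_n) (C1 x : 'rV[F]_n) : F :=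
  let b := (x *m (B2 *m invmx (C1 *m B2))) 0 0 in
  b * (Rmx B1 C1 0 0 * b - 2 * (x *m B1) 0 0).

Lemma Rmx_entry (F : realType) n (B1 : 'cV[F]_n) (C1 : 'rV[F]_n) :
  Rmx B1 C1 0 0 = 2 * (C1 *m B1) 0 0.
Proof. by rewrite /Rmx -trmx_mul !mxE mulr_natl. Qed.

Lemma gapZ (F : realType) n (B1 B2 : 'cV[F]_n) (C1 x : 'rV[F]_n) (c : F) :
  gap B1 B2 C1 (c *: x) = c ^+ 2 * gap B1 B2 C1 x.
Proof.
have ZE (M : 'M[F]_1) : (c *: M) 0 0 = c * M 0 0 by rewrite mxE.
by rewrite /gap -!scalemxAl !ZE; ring.
Qed.

(** The shift multiplies [b] by [1 - t] and lowers [2 w] by [t R b], because [R] is twice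
    [C1 *m B1]; hence the factor [R b - 2 w] does not change. *)
Lemma gap_shift (F : realType) n (B1 B2 : 'cV[F]_n) (C1 x : 'rV[F]_n) (t : F) :
  C1 *m B2 != 0 ->
  gap B1 B2 C1 (x - t *: (x *m (B2 *m invmx (C1 *m B2)) *m C1)) =
  (1 - t) * gap B1 B2 C1 x.
Proof.
move=> CB; rewrite /gap; set D := B2 *m _.
have CD : C1 *m D = 1%:M by rewrite mulmxA mulmxV // mx1_unit.
rewrite !mulmxBl -!scalemxAl -!(mulmxA (x *m D)) CD mulmx1.
rewrite [x *m D]mx11_scalar mul_scalar_mx Rmx_entry.
rewrite !mxE eqxx /=; set w := \sum_j x 0 j * _.
by ring.
Qed.

Lemma sym_pd1 (F : realType) (M : 'M[F]_1) : sym_pd M <-> 0 < M 0 0.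
Proof.
split=> [[_ /(_ 1%:M)]|M0].
  by rewrite trmx1 mul1mx mulmx1; apply; apply: oner_neq0.
split=> [|x x0]; first by apply/matrixP=> i j; rewrite !ord1 mxE.
rewrite !mxE big_ord1 !mxE big_ord1 !mxE mulrAC mulr_gt0 //.
rewrite -expr2 exprn_even_gt0 //=.
by apply: contra_neq x0 => x00; apply/matrixP=> i j; rewrite !ord1 mxE.
Qed.

Lemma sym_psd1 (F : realType) (M : 'M[F]_1) : 0 <= M 0 0 -> sym_psd M.
Proof.
move=> M0; split=> [|x]; first by apply/matrixP=> i j; rewrite !ord1 mxE.
rewrite !mxE big_ord1 !mxE big_ord1 !mxE mulrAC mulr_ge0 //.
by rewrite -expr2 sqr_ge0.
Qed.

Lemma dsubmx_trmx_mul (F : realType) n p q k (U : 'M[F]_(n, p + q))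
    (X : 'M[F]_(n, k)) :
  dsubmx (U^T *m X) = (rsubmx U)^T *m X.
Proof. by rewrite -{1}[U]hsubmxK tr_row_mx mul_col_mx col_mxKd. Qed.

(** * Scalar Lyapunov equations *)

Section Lyapunov.
Variables (F : realType) (n p : nat) (A : 'M[F]_n) (B1 B2 : 'cV[F]_n)
  (C1 : 'rV[F]_n) (eps : F) (U : 'M[F]_(n, p + 1)).

Let m := At22 A B2 C1 eps U 0 0.
Let R := Rmx B1 C1 0 0.
Let b := ((rsubmx U)^T *m (B2 *m invmx (C1 *m B2))) 0 0.
Let w := ((rsubmx U)^T *m B1) 0 0.

Lemma lyapunov_T_entry (T : 'M[F]_1) :
  (- At22 A B2 C1 eps U *m T - T *m (At22 A B2 C1 eps U)^T
   + Ct22 B1 B2 C1 U *m Rmx B1 C1 *m (Ct22 B1 B2 C1 U)^T) 0 0 =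
  (b - w / R) ^+ 2 * R - 2 * m * T 0 0.
Proof.
have CE : Ct22 B1 B2 C1 U 0 0 = b - w / R.
  rewrite /Ct22 dsubmx_trmx_mul mulmxBr [Rmx B1 C1]mx11_scalar invmx_scalar.
  have EE (X Y : 'M[F]_1) c : (X - c *: Y) 0 0 = X 0 0 - c * Y 0 0.
    by rewrite !mxE.
  by rewrite mul_mx_scalar -scalemxAr EE mulrC.
move: CE; rewrite /m /R.
move: (At22 _ _ _ _ _) (Ct22 _ _ _ _) (Rmx _ _) => a c r cE.
rewrite !(mxE, big_ord1) cE; ring.
Qed.

Lemma lyapunov_S_entry (S : 'M[F]_1) :
  (- At22 A B2 C1 eps U *m S - S *m (At22 A B2 C1 eps U)^T
   + Bt22 B1 U *m invmx (Rmx B1 C1) *m (Bt22 B1 U)^T) 0 0 =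
  w ^+ 2 / R - 2 * m * S 0 0.
Proof.
rewrite /Bt22 dsubmx_trmx_mul [Rmx B1 C1]mx11_scalar invmx_scalar -/R.
have : ((rsubmx U)^T *m B1) 0 0 = w by [].
rewrite /m; move: (At22 _ _ _ _ _) (_ *m B1) => a c cE.
rewrite !(mxE, big_ord1) cE eqxx mulr1n; ring.
Qed.

(** Subtracting the scalar equations leaves [(b - w / R) ^+ 2 * R - w ^+ 2 / R], in which the
    squares of [w] cancel. *)
Lemma lyapunov_pair_gap (T S : 'M[F]_1) :
  0 < R -> lyapunov_pair A B1 B2 C1 eps U T S ->
  2 * m * (T - S) 0 0 = gap B1 B2 C1 (rsubmx U)^T.
Proof.
move=> R0 [_ _ /(congr1 (fun X : 'M_1 => X 0 0)) hT].
move=> /(congr1 (fun X : 'M_1 => X 0 0)) hS _; move: hT hS.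
rewrite lyapunov_T_entry lyapunov_S_entry !mxE => /eqP hT /eqP hS.
move: hT hS; rewrite !subr_eq0 => /eqP hT /eqP hS.
rewrite mulrBr -hT -hS /gap -/b -/w -/R.
by field; rewrite gt_eqF.
Qed.

(** Each scalar equation is solved by dividing by [2 * m]; the two solutions differ by the gap over
    [2 * m]. *)
Lemma lyapunov_conditions_of_gap :
  0 < R -> 0 < m -> 0 < gap B1 B2 C1 (rsubmx U)^T ->
  lyapunov_conditions A B1 B2 C1 eps U.
Proof.
move=> R0 m0; rewrite /gap -/b -/w -/R => g0.
pose T : 'M[F]_1 := ((b - w / R) ^+ 2 * R / (2 * m))%:M.
pose S : 'M[F]_1 := (w ^+ 2 / R / (2 * m))%:M.
have TE : T 0 0 = (b - w / R) ^+ 2 * R / (2 * m) by rewrite mxE eqxx mulr1n.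
have SE : S 0 0 = w ^+ 2 / R / (2 * m) by rewrite mxE eqxx mulr1n.
have m20 : 2 * m != 0 by rewrite gt_eqF // mulr_gt0.
exists T, S; split.
- apply: sym_psd1; rewrite TE; apply: divr_ge0; last by rewrite pmulr_rge0 ?ltW.
  exact: mulr_ge0 (sqr_ge0 _) (ltW R0).
- apply: sym_psd1; rewrite SE; apply: divr_ge0; last by rewrite pmulr_rge0 ?ltW.
  exact: divr_ge0 (sqr_ge0 _) (ltW R0).
- apply/matrixP=> i j; rewrite !ord1 lyapunov_T_entry TE mxE.
  by rewrite [2 * m * _]mulrC divfK // subrr.
- apply/matrixP=> i j; rewrite !ord1 lyapunov_S_entry SE mxE.
  by rewrite [2 * m * _]mulrC divfK // subrr.
- apply/sym_pd1; rewrite mxE [(- S) _ _]mxE TE SE.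
  rewrite -mulrBl divr_gt0 ?mulr_gt0 //.
  suff -> : (b - w / R) ^+ 2 * R - w ^+ 2 / R = b * (R * b - 2 * w) by [].
  by field; rewrite gt_eqF.
Qed.

End Lyapunov.

(** * The closed loop *)

(** Eliminating [m] turns the two quantities into [- (R * b ^+ 2 / (2 * s))] and
    [(2 * w - R * b) ^+ 2 / (2 * R * s)]; the first is nonzero since [b = 0] would force [m = 0]. *)
Lemma closed_loop_scalars (F : realFieldType) (m R b w s : F) :
  0 < m -> 0 < R -> 0 < s -> 2 * m * s = b * (R * b - 2 * w) ->
  let k := (w - R * b) / s in
  m + k * b < 0 /\ 0 <= 2 * k * w / R - (m + k * b).
Proof.
move=> m0 R0 s0 ms k.
have s1 : s != 0 by rewrite gt_eqF.
have R1 : R != 0 by rewrite gt_eqF.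
have mE : m = b * (R * b - 2 * w) / (2 * s) by rewrite -ms; field.
have b0 : b != 0.
  by apply: contraTneq m0 => b0; rewrite mE b0 !mul0r ltxx.
have nuE : m + k * b = - (R * b ^+ 2 / (2 * s)) by rewrite mE /k; field.
split.
  rewrite nuE oppr_lt0; apply: divr_gt0; last exact: mulr_gt0.
  by rewrite pmulr_rgt0 // exprn_even_gt0.
have -> : 2 * k * w / R - (m + k * b) = (2 * w - R * b) ^+ 2 / (2 * R * s).
  by rewrite nuE /k; field; rewrite s1 R1.
apply: divr_ge0; first exact: sqr_ge0.
by rewrite ltW // mulr_gt0 ?mulr_gt0.
Qed.

(** The polynomial row [L] is a certificate that [L / q] equals [C] times the resolvent, so that no
    inverse has to be computed. *)
Lemma tf_of_ss_entry (F : realType) n (M : 'M[F]_n) (B : 'cV[F]_n)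
    (C : 'rV[F]_n) (L : 'rV[{poly F}]_n) (q : {poly F}) :
  L *m char_poly_mx M = q *: map_mx polyC C ->
  tf_of_ss M B C 0 0 * tofrac q = tofrac ((L *m map_mx polyC B) 0 0).
Proof.
move=> /(congr1 (map_mx (@tofrac _))); rewrite map_mxM map_mxZ.
set X := map_mx _ (char_poly_mx M) => LX.
have Xu : X \in unitmx.
  rewrite unitmxE det_map_mx unitfE tofrac_eq0.
  by rewrite monic_neq0 // char_poly_monic.
have mapC k l (Y : 'M[F]_(k, l)) :
    map_mx (fun x : F => tofrac x%:P) Y = map_mx (@tofrac _) (map_mx polyC Y).
  by rewrite -map_mx_comp.
rewrite /tf_of_ss !mapC -/X mulrC.
have -> : tofrac ((L *m map_mx polyC B) 0 0) =
    (map_mx (@tofrac _) L *m map_mx (@tofrac _) (map_mx polyC B)) 0 0.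
  by rewrite -map_mxM [RHS]mxE.
have -> : map_mx (@tofrac _) L =
    tofrac q *: (map_mx (@tofrac _) (map_mx polyC C) *m invmx X).
  by rewrite scalemxAl -LX mulmxK.
by rewrite -scalemxAl [RHS]mxE.
Qed.

Section ClosedLoop.
Variables (F : realType) (n p : nat) (A : 'M[F]_n) (B1 B2 : 'cV[F]_n)
  (C1 : 'rV[F]_n) (eps : F) (U : 'M[F]_(n, p + 1)) (T S : 'M[F]_1).
Hypothesis hCB : C1 *m B2 != 0.

Let m := At22 A B2 C1 eps U 0 0.
Let R := Rmx B1 C1 0 0.
Let D := B2 *m invmx (C1 *m B2).
Let u := rsubmx U.
Let b := (u^T *m D) 0 0.
Let w := (u^T *m B1) 0 0.
Let kappa := (w - R * b) / (T - S) 0 0.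
Let Acl := A + B2 *m feedback A B1 B2 C1 eps U T S.

(** Since [Pmx U T S] is [u *m u^T] divided by [T - S], its terms in the feedback contribute the
    rank one matrix; the terms [- C1 *m A - eps *: C1] turn [A + eps%:M] into [Armx]. *)
Lemma closed_loop_shift :
  Acl + eps%:M = Armx A B2 C1 eps + kappa *: (D *m u^T).
Proof.
rewrite /kappa; set s := (T - S) 0 0.
have PE : Pmx U T S = s^-1 *: (u *m u^T).
  rewrite /Pmx -{1 2}[U]hsubmxK tr_row_mx mul_row_block !mulmx0 !addr0 add0r.
  rewrite mul_row_col mul0mx add0r (mx11_scalar (T - S)) -/s invmx_scalar.
  by rewrite mul_mx_scalar -scalemxAl.
have uE (X : 'cV[F]_n) : X^T *m Pmx U T S = ((u^T *m X) 0 0 / s) *: u^T.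
  rewrite PE -scalemxAr mulmxA -[X^T *m u]trmxK trmx_mul trmxK.
  set y := (_ *m X) 0 0; have -> : u^T *m X = y%:M by exact: mx11_scalar.
  by rewrite tr_scalar_mx mul_scalar_mx scalerA mulrC.
rewrite /Acl /feedback mulmxA -/D -trmx_mul -trmx_inv.
rewrite -!mulmxA [_^T *m (B2^T *m _)]mulmxA -trmx_mul -/D !uE.
rewrite [Rmx B1 C1]mx11_scalar mul_scalar_mx -/R -/w -/b.
rewrite /Armx /Qmx -/D mulmxBl mul1mx !mulmxBr mulmxDr mul_mx_scalar -!scalemxAr.
rewrite scalerA mulrBl scalerBl -!mulmxA mulrA.
move: (_ *: _) (B2 *m (_ *m (C1 *m A))) (eps *: _) (_ *: _) eps%:M => X1 X2 X3 X4 X5.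
by apply/matrixP=> i j; rewrite !mxE; ring.
Qed.

Lemma C1_closed_loop : C1 *m Acl = kappa *: u^T - eps *: C1.
Proof.
apply/eqP; rewrite eq_sym subr_eq -(mul_mx_scalar eps) -mulmxDr closed_loop_shift.
rewrite mulmxDr mul_C1_Armx // add0r -scalemxAr !mulmxA mulmxV ?mx1_unit //.
by rewrite mul1mx.
Qed.

Hypothesis hU : ordered_schur A B2 C1 eps U.

Lemma left_unstable_closed_loop : u^T *m (Acl + eps%:M) = (m + kappa * b) *: u^T.
Proof.
rewrite closed_loop_shift mulmxDr unstable_left_eigenvector // -scalemxAr mulmxA.
by rewrite [u^T *m D]mx11_scalar mul_scalar_mx scalerA -scalerDl.
Qed.

(** In the basis [U] the shifted closed loop stays block triangular. The rank one term vanishes on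
    the first [p] columns of [U], which are orthogonal to [u], so it leaves the upper left block
    intact and only moves the last diagonal entry. *)
Lemma closed_loop_eigenvalue (z : F[i]) :
  is_eigenvalue Acl z -> complex.Re z <= - eps \/ z = (m + kappa * b - eps)%:C.
Proof.
move=> /eigenvalueP[x xA x0].
case: (hU) => -[UtU UUt] _ dl0 ul_le0 _.
have [ul0 uu1] := orthogonal_block_cols UtU.
set H := Acl + eps%:M.
have Hz : is_eigenvalue H (z + eps%:C).
  apply/eigenvalueP; exists x => //.
  rewrite /H /complex_mx map_mxD map_scalar_mx mulmxDr mul_mx_scalar.
  by rewrite -/(complex_mx _) xA scalerDl.
have := orthogonal_conj_eigenvalue UUt Hz.
set N := U^T *m H *m U.
have dN : dsubmx N = (m + kappa * b) *: row_mx 0 1%:M.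
  rewrite /N -mulmxA dsubmx_trmx_mul mulmxA left_unstable_closed_loop -scalemxAl.
  by rewrite -[U]hsubmxK mul_mx_row ul0 uu1.
have dlN : dlsubmx (complex_mx N) = 0.
  rewrite /complex_mx -map_dlsubmx -(map_mx0 (real_complex F)); congr map_mx.
  by rewrite /dlsubmx dN scale_row_mx row_mxKl scaler0.
have drN : drsubmx N = (m + kappa * b)%:M.
  by rewrite /drsubmx dN scale_row_mx row_mxKr scalemx1.
have ulN : ulsubmx N = ulsubmx (U^T *m Armx A B2 C1 eps *m U).
  rewrite /N /H closed_loop_shift mulmxDr mulmxDl -scalemxAr -scalemxAl.
  rewrite (mulmxA U^T D) -(mulmxA _ u^T) -[U in u^T *m U]hsubmxK mul_mx_row.
  rewrite ul0 mul_mx_row mulmx0; move: (_ *m U) => X; move: (_ *m _) => Y.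
  by apply/matrixP=> i j; rewrite !mxE (unsplitK (inl _)) !mxE mulr0 addr0.
move=> /(block_trig_eigenvalue dlN)[].
  rewrite /complex_mx -map_ulsubmx ulN => /ul_le0 h; left; move: h.
  by case: z {xA Hz} => x1 y1 /=; lra.
rewrite /complex_mx -map_drsubmx drN map_scalar_mx => /eigenvalueP[y].
rewrite mul_mx_scalar => /eqP + y0; rewrite -subr_eq0 -scalerBl scaler_eq0.
rewrite (negbTE y0) orbF subr_eq0 => /eqP h; right.
by rewrite rmorphB /= h addrK.
Qed.

Lemma closed_loop_tf :
  tf_of_ss Acl B1 C1 0 0
  * tofrac (('X + eps%:P) * ('X + (eps - (m + kappa * b))%:P)) =
  tofrac ((C1 *m B1) 0 0 *: ('X + (eps - (m + kappa * b))%:P)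
          + (kappa * w)%:P).
Proof.
set nu := m + kappa * b.
(* [C1] and [u^T] span an invariant space on which [Acl] is triangular; these coefficients make the
   [u^T] terms of [L *m char_poly_mx Acl] cancel. *)
pose L := ('X + (eps - nu)%:P) *: map_mx polyC C1
          + kappa%:P *: map_mx polyC u^T.
have uAcl : u^T *m Acl = (nu - eps) *: u^T.
  apply/eqP; rewrite scalerBl eq_sym subr_eq -left_unstable_closed_loop.
  by rewrite mulmxDr mul_mx_scalar.
rewrite (@tf_of_ss_entry _ _ _ _ _ L).
  have EE (Y Z : 'M[F]_1) a c : (a *: map_mx polyC Y + c *: map_mx polyC Z) 0 0
      = a * (Y 0 0)%:P + c * (Z 0 0)%:P by rewrite !mxE.
  congr tofrac; rewrite /L mulmxDl -!scalemxAl -!map_mxM EE -/w.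
  by rewrite -mul_polyC (polyCM kappa); ring.
rewrite /L /char_poly_mx mulmxBr !mulmxDl -!scalemxAl !mul_mx_scalar -!map_mxM.
rewrite C1_closed_loop uAcl map_mxB !map_mxZ.
move: (map_mx _ C1) (map_mx _ u^T) => X Y.
by apply/matrixP=> i j; rewrite !mxE !polyCD !polyCN; ring.
Qed.

Lemma closed_loop_SNI_and_stable :
  0 < eps -> 0 < R -> lyapunov_pair A B1 B2 C1 eps U T S ->
  SNI (tf_of_ss Acl B1 C1) /\ degree_of_stability Acl eps.
Proof.
move=> eps0 R0 hTS.
have [_ _ _ _ /sym_pd1 s0] := hTS.
have m0 : 0 < m := unstable_eigenvalue_gt0 hU.
have ms := lyapunov_pair_gap R0 hTS.
have [nu0 c0] := closed_loop_scalars m0 R0 s0 ms.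
rewrite -/kappa in nu0 c0; set nu := m + kappa * b in nu0 c0.
split; last first.
  move=> z /closed_loop_eigenvalue[//|->] /=; rewrite -/nu; lra.
(* The zero comes from factoring [R / 2], which is [C1 *m B1], out of the numerator in
   [closed_loop_tf]. *)
apply: (@SNI_second_order _ _ (R / 2) (eps + (2 * kappa * w / R - nu)) eps (eps - nu)).
- by rewrite divr_gt0.
- by [].
- by lra.
(* The difference of the two sides is [eps * eps + 2 * (c * eps) + c * - nu]. *)
- move: c0; set c := _ - nu => c0.
  have h1 : 0 <= c * eps by rewrite mulr_ge0 // ltW.
  have h2 : 0 <= c * - nu by rewrite mulr_ge0 // oppr_ge0 ltW.
  have h3 : 0 <= eps * eps by rewrite -expr2 sqr_ge0.
  by lra.
rewrite closed_loop_tf -/nu; congr tofrac.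
have -> : (C1 *m B1) 0 0 = R / 2 by rewrite /R Rmx_entry; field.
have -> : kappa * w = R / 2 * (2 * kappa * w / R) by field; rewrite gt_eqF.
by rewrite -!mul_polyC !polyCD !polyCM !polyCN; ring.
Qed.
End ClosedLoop.

(* The eigenvalues of A_q are lam 1, ..., lam n (1-based; other values of lam
   are irrelevant). *)
Theorem mainTheorem1 (F : realType) (n : nat) (hn : (3 <= n)%N)
  (A : 'M[F]_n) (B1 B2 : 'cV[F]_n) (C1 : 'rV[F]_n)
  (hC1B2 : C1 *m B2 != 0)
  (hR : 0 < Rmx B1 C1 0 0)
  (hctrl : controllable A B2)
  (lam : nat -> F[i])
  (lam_eig : forall k : nat, (1 <= k <= n)%N ->
     is_eigenvalue (Aqmx A B2 C1) (lam k))
  (lam_distinct : forall k l : nat, (1 <= k <= n)%N -> (1 <= l <= n)%N ->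
     lam k = lam l -> k = l)
  (lam_ordered : forall k l : nat, (1 <= k)%N -> (k <= l)%N ->
     (l <= n - 2)%N -> complex.Re (lam k) <= complex.Re (lam l))
  (lam_stable : complex.Re (lam (n - 2)%N) < 0)
  (lam_zero : lam (n - 1)%N = 0)
  (lam_unstable : 0 < lam n)
  (p0 q0 : nat) (U0 : 'M[F]_(n, p0 + q0))
  (hU0 : ordered_schur A B2 C1 0 U0)
  (hlyap0 : lyapunov_conditions A B1 B2 C1 0 U0) :
  let gamma := - complex.Re (lam (n - 2)%N) in
  forall eps : F, 0 < eps -> eps < gamma ->
  forall (p q : nat) (U : 'M[F]_(n, p + q)),
    ordered_schur A B2 C1 eps U ->
    lyapunov_conditions A B1 B2 C1 eps U /\
    forall T S : 'M[F]_q, lyapunov_pair A B1 B2 C1 eps U T S ->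
      let K := feedback A B1 B2 C1 eps U T S in
      SNI (tf_of_ss (A + B2 *m K) B1 C1) /\
      degree_of_stability (A + B2 *m K) eps.
Proof.
move=> gamma eps eps0 epsg p q U hU.
have R0 := hR.
have q01 : q0 = 1%N.
  apply: (unstable_block_size1 hn hC1B2 lam_eig lam_distinct lam_ordered lam_stable
    lam_zero lam_unstable (lexx 0) _ hU0).
  by rewrite oppr_gt0.
have q1 : q = 1%N := unstable_block_size1 hn hC1B2 lam_eig lam_distinct lam_ordered
  lam_stable lam_zero lam_unstable (ltW eps0) epsg hU.
subst q q0; split; last by move=> T S hTS; exact: closed_loop_SNI_and_stable hTS.
have m0 := unstable_eigenvalue_gt0 hU.
apply: lyapunov_conditions_of_gap => //.
have [T0 [S0 hTS0]] := hlyap0.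
have [_ _ _ _ /sym_pd1 s0] := hTS0.
have l0 := unstable_eigenvalue_gt0 hU0.
have g0 := lyapunov_pair_gap hR hTS0.
have uA := unstable_left_eigenvector hU0.
set l := At22 _ _ _ _ _ 0 0 in l0 g0 uA.
set u0 := (rsubmx U0)^T in g0 uA.
have le0 : 0 < l + eps by rewrite addr_gt0.
set D := B2 *m invmx (C1 *m B2).
have CD : C1 *m D = 1%:M by rewrite mulmxA mulmxV // mx1_unit.
have uAq : u0 *m ((1%:M - D *m C1) *m A) = l *: u0.
  by rewrite -uA /Armx (raddf0 (@scalar_mx _ _)) addr0.
have := left_eigenvector_shift CD uAq (lt0r_neq0 le0).
move=> /(unstable_left_eigenvector_unique hU le0)[c xE].
have := gap_shift B1 u0 (eps / (l + eps)) hC1B2.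
rewrite -/D xE gapZ -g0.
have -> : 1 - eps / (l + eps) = l / (l + eps) by field; rewrite gt_eqF.
move=> h; have : 0 < c ^+ 2 * gap B1 B2 C1 (rsubmx U)^T.
  by rewrite h mulr_gt0 ?divr_gt0 ?mulr_gt0.
have [->|c0] := eqVneq c 0; first by rewrite expr0n mul0r ltxx.
by rewrite pmulr_rgt0 // exprn_even_gt0.
Qed.
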